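(* There exists an absolute constant $c>0$ such that for every $n\ge 1$ there is an $n$-vertex complete simple topological graph drawn in the unit square $[0,1]^2$ such that every face it generates (i.e. every $k$-face, for every $k\ge 3$) has area at least $c/n$.
   Context: A topological graph is a graph drawn in the plane with vertices represented by distinct points and edges represented by non-self-intersecting curves joining the corresponding points; edges do not pass through vertices other than their endpoints, and if two edges share an interior point they properly cross there. A topological graph is simple if any two of its edges intersect at most once, either at a common endpoint or at a proper crossing. It is complete if its underlying graph is the complete graph $K_n$. A subgraph is plane if no two of its edges cross. A $k$-face generated by $G$ is the bounded open cell enclosed by a plane cycle of length $k$ in $G$. ''Drawn in the unit square'' means all vertices and edges lie in $[0,1]^2$. *)

(* Defs.v *)
From HB Require Import structures.
From mathcomp Require Export all_boot all_order all_algebra.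
From mathcomp Require Export all_classical all_reals all_analysis.

Set Implicit Arguments.
Unset Strict Implicit.
Unset Printing Implicit Defensive.

Export Order.TTheory GRing.Theory Num.Theory.
Export numFieldNormedType.Exports.

Local Open Scope classical_set_scope.
Local Open Scope ring_scope.

Definition homeomorphism_on (S T : topologicalType) (U : set S) (W : set T)
    (f : S -> T) (g : T -> S) : Prop :=
  [/\ set_bij U W f, {in U, cancel f g},
      {within U, continuous f} & {within W, continuous g}].

Definition open_square (R : realType) : set (R * R) :=
  [set z | (-1 < z.1 < 1) /\ (-1 < z.2 < 1)].

(* Two curves, given by their images A and B, cross properly at p when some
   neighbourhood of p can be mapped homeomorphically onto the open square
   ]-1, 1[^2 so that p becomes the origin and A, B become the two coordinate
   axes.  In particular, they do not touch or overlap there. *)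
Definition properly_cross_at (R : realType) (A B : set (R * R)) (p : R * R)
    : Prop :=
  exists (U : set (R * R)) (f g : R * R -> R * R),
    [/\ open U /\ U p,
        homeomorphism_on U (@open_square R) f g,
        f p = (0, 0),
        f @` (A `&` U) = [set z | open_square z /\ z.2 = 0] &
        f @` (B `&` U) = [set z | open_square z /\ z.1 = 0]].

(* tg_arc u v is a parametrization by [0, 1], from u to v, of the edge uv; it
   is only meaningful when u and v are adjacent.  An edge is undirected:
   tg_arc v u is the same curve traversed backwards. *)
Record topological_graph (R : realType) (V : finType) := TopologicalGraph {
  tg_adj : rel V ;
  tg_adj_sym : symmetric tg_adj ;
  tg_adj_irrefl : irreflexive tg_adj ;
  tg_pos : V -> R * R ;
  tg_pos_inj : injective tg_pos ;
  tg_arc : V -> V -> R -> R * R ;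
  tg_arc_rev : forall u v, tg_adj u v ->
    forall t : R, t \in `[0, 1] -> tg_arc v u t = tg_arc u v (1 - t) ;
  tg_arc_continuous : forall u v, tg_adj u v ->
    {within `[0, 1], continuous (tg_arc u v)} ;
  tg_arc_inj : forall u v, tg_adj u v -> set_inj `[0, 1] (tg_arc u v) ;
  tg_arc0 : forall u v, tg_adj u v -> tg_arc u v 0 = tg_pos u ;
  tg_arc1 : forall u v, tg_adj u v -> tg_arc u v 1 = tg_pos v ;
  tg_arc_avoid : forall u v, tg_adj u v ->
    forall (w : V) (t : R), t \in `]0, 1[ -> tg_arc u v t <> tg_pos w ;
  tg_arc_cross : forall u v x y, tg_adj u v -> tg_adj x y ->
    [set u; v]%SET != [set x; y]%SET ->
    forall p, (tg_arc u v @` `]0, 1[) p -> (tg_arc x y @` `]0, 1[) p ->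
    properly_cross_at (tg_arc u v @` `[0, 1]) (tg_arc x y @` `[0, 1]) p
}.

Section TopologicalGraphs.
Variables (R : realType) (V : finType) (G : topological_graph R V).

Definition edge_curve (u v : V) : set (R * R) := tg_arc G u v @` `[0, 1].

Definition edge_interior (u v : V) : set (R * R) := tg_arc G u v @` `]0, 1[.

Definition complete_graph : Prop := forall u v, u != v -> tg_adj G u v.

(* In a topological graph a point shared by two distinct edges is either a
   common endpoint or a proper crossing (tg_arc_avoid and tg_arc_cross), so
   only the number of shared points remains to be constrained. *)
Definition simple_drawing : Prop :=
  forall u v x y, tg_adj G u v -> tg_adj G x y ->
    [set u; v]%SET != [set x; y]%SET ->
    forall p q, (edge_curve u v `&` edge_curve x y) p ->
                (edge_curve u v `&` edge_curve x y) q -> p = q.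

Definition drawn_in (D : set (R * R)) : Prop :=
  (forall u, D (tg_pos G u)) /\
  (forall u v, tg_adj G u v -> edge_curve u v `<=` D).

Definition edges_cross (u v x y : V) : Prop :=
  exists p, [/\ edge_interior u v p, edge_interior x y p &
                properly_cross_at (edge_curve u v) (edge_curve x y) p].

Definition plane_subgraph (e : rel V) : Prop :=
  forall u v x y, e u v -> e x y -> [set u; v]%SET != [set x; y]%SET ->
    ~ edges_cross u v x y.

Definition cycle_edge (c : seq V) : rel V :=
  [rel u v | (u \in c) && (v == next c u)].

Definition plane_cycle (k : nat) (c : seq V) : Prop :=
  [/\ (3 <= k)%N, size c = k, ucycle (tg_adj G) c &
      plane_subgraph (cycle_edge c)].

Definition cycle_curve (c : seq V) : set (R * R) :=
  \bigcup_(u in [set` c]) edge_curve u (next c u).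

(* The curve of a plane cycle is a Jordan curve, so its complement has exactly
   one bounded connected component: the cell enclosed by the cycle. *)
Definition kface (k : nat) (F : set (R * R)) : Prop :=
  exists2 c, plane_cycle k c &
  exists p, [/\ (~` cycle_curve c) p,
                F = connected_component (~` cycle_curve c) p &
                bounded_set F].

End TopologicalGraphs.

Definition unit_square (R : realType) : set (R * R) :=
  [set z | (0 <= z.1 <= 1) /\ (0 <= z.2 <= 1)].

Definition area (R : realType) (A : set (R * R)) : \bar R :=
  (lebesgue_measure \x lebesgue_measure)%E A.

(* Main.v *)
(* Draw the vertex i at (i, 0) and the edge uv as the arc of the parabola
   y = (x - u)(v - x) above the axis. All these parabolas have the same leading
   coefficient, so that two of them meet at most once, and transversally. An
   edge passing over w is at height at least 1 there, and an edge ending at w is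
   close to 0, so a small cell of width of order 1/n just above w meets no edge.
   In a face, consider two edges of the cycle that are consecutive on a vertical
   line. Since they do not cross, they are nested: the upper one passes over an
   endpoint w of the lower one, and the strip between them, which avoids the
   cycle, leads into the cell of w. Each face thus contains a cell, and two
   homeomorphisms of the axes shrink the drawing to the unit square while keeping
   the cells at width of order 1/n and constant height. *)
Require Import Defs.
From mathcomp Require Import ring lra.

Set Implicit Arguments.
Unset Strict Implicit.
Unset Printing Implicit Defensive.

Local Open Scope classical_set_scope.
Local Open Scope ring_scope.

(** * Parabolas with leading coefficient -1 and given roots *)

Definition parab (R : realType) (a b x : R) : R := (x - a) * (b - x).

Section Parabolas.
Variable R : realType.
Implicit Types a b c d x y t : R.

Lemma parabC a b x : parab a b x = parab b a x.
Proof. by rewrite /parab; ring. Qed.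

Lemma parab_l a b : parab a b a = 0.
Proof. by rewrite /parab; ring. Qed.

Lemma parab_r a b : parab a b b = 0.
Proof. by rewrite /parab; ring. Qed.

Lemma parab_conv a b x y t :
  parab a b (x + t * (y - x)) =
    (1 - t) * parab a b x + t * parab a b y + t * (1 - t) * (y - x) ^+ 2.
Proof. by rewrite /parab; ring. Qed.

Lemma parab_param a b t :
  parab a b (a + t * (b - a)) = t * (1 - t) * (b - a) ^+ 2.
Proof. by rewrite /parab; ring. Qed.

Lemma parab_eq0 a b x : parab a b x = 0 -> x = a \/ x = b.
Proof.
move=> /eqP; rewrite /parab mulf_eq0 !subr_eq0.
by case/orP=> /eqP ->; [left|right].
Qed.

Lemma parab_sub a b c d x :
  parab a b x - parab c d x = (a + b - c - d) * x - (a * b - c * d).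
Proof. by rewrite /parab; ring. Qed.

(* The two parabolas have the same leading coefficient, so that their
   difference is affine; concavity keeps the crossing point above the axis. *)
Lemma parab_crossing a b c d x y :
    parab c d x <= parab a b x -> parab a b y < parab c d y ->
    0 < parab a b x -> 0 <= parab a b y \/ 0 <= parab c d y /\ 0 < parab c d x ->
  exists2 z, parab a b z = parab c d z & 0 < parab a b z.
Proof.
move=> lex lty px py.
set D := parab a b x - parab c d x; set E := parab c d y - parab a b y.
have D0 : 0 <= D by rewrite /D; lra.
have E0 : 0 < E by rewrite /E; lra.
have DE0 : D + E != 0 by rewrite gt_eqF//; lra.
(* The affine difference equals [D] at [x] and [- E] at [y]; [t] is the parameter of its zero
   between them. *)
pose t := D / (D + E).
have t0 : 0 <= t by apply: divr_ge0; lra.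
have t1 : t < 1 by rewrite ltr_pdivrMr; lra.
have tE : t * (D + E) = D by rewrite /t mulfVK.
have eqz : parab a b (x + t * (y - x)) = parab c d (x + t * (y - x)).
  rewrite !parab_conv; move: tE; rewrite /D /E => tE; lra.
have sq : 0 <= t * (1 - t) * (y - x) ^+ 2.
  by apply: mulr_ge0; [apply: mulr_ge0; lra|exact: sqr_ge0].
exists (x + t * (y - x)) => //.
case: py => [py|[py px']].
- rewrite parab_conv.
  have := mulr_gt0 (_ : 0 < 1 - t) px; have := mulr_ge0 t0 py; lra.
- rewrite eqz parab_conv.
  have := mulr_gt0 (_ : 0 < 1 - t) px'; have := mulr_ge0 t0 py; lra.
Qed.

(** The difference is affine, and an affine function with two distinct zeros vanishes
    identically. *)
Lemma parab_meet_once a b c d x y :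
    parab a b x = parab c d x -> parab a b y = parab c d y -> x != y ->
  parab a b =1 parab c d.
Proof.
move=> ex ey xy z.
have := parab_sub a b c d x; rewrite ex subrr => ex'.
have := parab_sub a b c d y; rewrite ey subrr => ey'.
have s0 : a + b - c - d = 0.
  have : (a + b - c - d) * (x - y) = 0 by lra.
  move/eqP; rewrite mulf_eq0 (subr_eq0 x) (negbTE xy) orbF.
  by move/eqP.
apply/eqP; rewrite -subr_eq0 parab_sub s0; apply/eqP.
by move: ex'; rewrite s0; lra.
Qed.

(** Comparing values at 0, then at 1, equates the products, then the sums, of the roots. *)
Lemma parab_inj a b c d :
  parab a b =1 parab c d -> (a = c /\ b = d) \/ (a = d /\ b = c).
Proof.
move=> e.
have e0 : a * b = c * d by have := parab_sub a b c d 0; rewrite e; lra.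
have e1 : a + b = c + d by have := parab_sub a b c d 1; rewrite e; lra.
have : parab a b c = 0 by rewrite e parab_l.
by case/parab_eq0 => ca; [left|right]; split; lra.
Qed.

End Parabolas.

(** * Families of pairwise non-crossing arcs *)

Section NoCrossing.
Variables (R : realType) (T : finType) (P : pred T) (l r : T -> R).

Notation f i := (parab (l i) (r i)).

(* Two members of a family of pairwise non-crossing arcs with feet [l i] and
   [r i] that are consecutive on the vertical line at [x]: the upper one passes
   over a foot of the lower one, and the strip between them is empty. *)
Lemma noncrossing_strip (x y : R) :
    (forall i j z, P i -> P j -> f i z = f j z -> 0 < f i z -> f i =1 f j) ->
    (forall i, P i -> f i x != 0) ->
    (forall i, P i -> 0 <= f i x -> f i x != y) ->
    (exists2 i, P i & 0 <= f i x < y) ->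
    (exists2 i, P i & y < f i x) -> 0 < y ->
  exists i j w, [/\ P i /\ P j, 0 < f i x < y /\ y < f j x,
    w = l i \/ w = r i, 0 < f j w &
    forall k z, P k -> 0 <= f i z -> 0 <= f k z -> ~~ (f i z < f k z < f j z)].
Proof.
move=> nc nint ny [i0 Pi0 i0y] [j0 Pj0 j0y] y0.
(* On the vertical line at [x], take for [i] the highest arc of nonnegative height below [y], and
   for [j] the lowest arc above [y]. *)
have [i [Pi iy imax]] : exists i, [/\ P i, 0 <= f i x < y &
    forall k, P k -> 0 <= f k x < y -> f k x <= f i x].
  have Q0 : [pred k | P k && (0 <= f k x < y)] i0 by rewrite /= Pi0 i0y.
  case: (@arg_maxP _ _ _ i0 [pred k | P k && (0 <= f k x < y)] (fun k => f k x) Q0).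
  move=> i /= /andP[Pi iy] im; exists i; split=> // k Pk ky.
  by apply: im; rewrite /= Pk ky.
have [j [Pj jy jmin]] : exists j, [/\ P j, y < f j x &
    forall k, P k -> y < f k x -> f j x <= f k x].
  have Q0 : [pred k | P k && (y < f k x)] j0 by rewrite /= Pj0 j0y.
  case: (@arg_minP _ _ _ j0 [pred k | P k && (y < f k x)] (fun k => f k x) Q0).
  move=> j /= /andP[Pj jy] jm; exists j; split=> // k Pk ky.
  by apply: jm; rewrite /= Pk ky.
have ipos : 0 < f i x.
  by case/andP: iy => i1 _; rewrite lt_neqAle eq_sym nint.
have iltj : f i x < f j x by case/andP: iy => _ i2; lra.
(* If [j] were negative at a foot of [i], their order would be reversed from that at [x], so they
   would cross above the axis; [nc] would equate them, against [iltj]. *)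
have jfoot w : f i w = 0 -> 0 <= f j w.
  move=> w0; rewrite leNgt; apply/negP => jw.
  have lt1 : f j w < f i w by rewrite w0.
  have [] := @parab_crossing _ (l j) (r j) (l i) (r i) x w (ltW iltj) lt1.
  - lra.
  - by right; rewrite w0.
  move=> z ez zp.
  have := nc _ _ _ Pj Pi ez zp => /(_ x); lra.
(* If [j] vanished at both feet of [i], which are distinct since [i] is positive at [x], the two
   parabolas would coincide. *)
have [w [iw jw]] : exists w, (w = l i \/ w = r i) /\ 0 < f j w.
  apply: contrapT => /forallNP H.
  have foot0 w : (w = l i \/ w = r i) -> f j w = 0.
    move=> iw; have := H w; have w0 : f i w = 0.
      by case: iw => ->; [exact: parab_l|exact: parab_r].
    have := jfoot _ w0; rewrite le_eqVlt => /orP[/eqP <- //|jw /not_andP[]//].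
  have lr : l i != r i.
    apply/eqP => lr; move: ipos; rewrite /parab lr.
    have := sqr_ge0 (x - r i); rewrite expr2; lra.
  have := @parab_meet_once _ (l i) (r i) (l j) (r j) (l i) (r i).
  rewrite parab_l parab_r !foot0; [|by right|by left].
  by move=> /(_ erefl erefl lr)/(_ x); lra.
exists i, j, w; split=> //.
  by split => //; rewrite ipos; case/andP: iy.
move=> k z Pk iz kz; apply/negP => /andP[ik kj].
(* An arc [k] strictly inside the strip at [z] cannot change order with [i] or [j] without crossing
   it, so it is strictly between them at [x] too, against the choice of [i] and [j]. *)
have ikx : f i x < f k x.
  rewrite ltNge; apply/negP => kix.
  have [|z' ez zp] := parab_crossing kix ik ipos; first by left.
  have := nc _ _ _ Pi Pk ez zp => /(_ z); lra.
have kjx : f k x < f j x.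
  rewrite ltNge; apply/negP => jkx.
  have kp : 0 < f k x by lra.
  have [|z' ez zp] := parab_crossing jkx kj kp; first by left.
  have := nc _ _ _ Pk Pj ez zp => /(_ z); lra.
have [kxy|kxy|kxy] := ltgtP (f k x) y.
- have := imax k Pk; have -> : 0 <= f k x < y by rewrite kxy andbT; lra.
  by move=> /(_ isT); lra.
- by have := jmin k Pk kxy; lra.
- by have := ny k Pk; rewrite kxy eqxx => /(_ (ltW y0)).
Qed.

End NoCrossing.

(** * Connectedness, open sets and area in the plane *)

Lemma continuous_pair (S T U : topologicalType) (f : S -> T) (g : S -> U) :
  continuous f -> continuous g -> continuous (fun s => (f s, g s)).
Proof. by move=> fc gc s; apply: cvg_pair; [exact: fc|exact: gc]. Qed.

Lemma path_connected_component (R : realType) (T : topologicalType) (S : set T)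
    (g : R -> T) :
  continuous g -> (forall t, 0 <= t <= 1 -> S (g t)) ->
  connected_component S (g 0) (g 1).
Proof.
move=> gc gS.
have gcon : connected (g @` `[0, 1]).
  apply: connected_continuous_connected; last exact: continuous_subspaceT.
  exact/connected_intervalP/interval_is_interval.
apply: (@connected_component_max _ S (g @` `[0, 1])) => //.
- by exists 0 => //=; rewrite in_itv /= lexx ler01.
- by move=> _ [t t01 <-]; apply: gS; move: t01; rewrite /= in_itv.
- by exists 1 => //=; rewrite in_itv /= lexx ler01.
Qed.

Lemma segment_connected_component (R : realType) (S : set (R * R)) (p q : R * R) :
  (forall t, 0 <= t <= 1 ->
     S (p.1 + t * (q.1 - p.1), p.2 + t * (q.2 - p.2))) ->
  connected_component S p q.
Proof.
case: p q => [p1 p2] [q1 q2] /= pqS.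
pose g (t : R) := (p1 + t * (q1 - p1), p2 + t * (q2 - p2)).
have -> : (p1, p2) = g 0 by rewrite /g !mul0r !addr0.
have -> : (q1, q2) = g 1 by rewrite /g !mul1r !subrKC.
apply: path_connected_component => //.
by apply: continuous_pair => t; apply: cvgD; try exact: cvg_cst;
  apply: cvgM; try exact: cvg_cst; exact: cvg_id.
Qed.

(** Balls of the product metric are squares, hence convex: a segment joins each point of a ball to
    its centre, so the ball stays in the component. *)
Lemma open_component_prod (R : realType) (S : set (R * R)) (p : R * R) :
  open S -> open (connected_component S p).
Proof.
rewrite !openE => oS q pq; have Sq := connected_component_sub pq.
have := oS q Sq; rewrite /interior => /nbhs_ballP[e /= e0 eS].
apply/nbhs_ballP; exists e => //= z qz.
apply: connected_component_trans pq _.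
apply: segment_connected_component => t /andP[t0 t1]; apply: eS.
have bb (a b : R) : ball a e b -> ball a e (a + t * (b - a)).
  rewrite /ball /= => ab; have -> : a - (a + t * (b - a)) = t * (a - b) by ring.
  rewrite normrM ger0_norm//; apply: le_lt_trans ab.
  by rewrite -[leRHS]mul1r ler_wpM2r.
by case: qz => qz1 qz2; split; apply: bb.
Qed.

(** Measurability refers to the product sigma-algebra, so the open set is written as a countable
    union of boxes with rational corners. *)
Lemma open_measurable_prod (R : realType) (A : set (R * R)) :
  open A -> measurable A.
Proof.
rewrite openE => oA.
pose box (q : rat * rat * (rat * rat)) : set (R * R) :=
  `]ratr q.1.1, ratr q.1.2[ `*` `]ratr q.2.1, ratr q.2.2[.
have -> : A = \bigcup_(q in [set q | box q `<=` A]) box q.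
  apply/seteqP; split=> [[x y] Axy|z [q /= qA /qA//]].
  have := oA _ Axy; rewrite /interior => /nbhs_ballP[e /= e0 eA].
  have [a1] := @rat_in_itvoo R (x - e) x ltac:(lra).
  have [b1] := @rat_in_itvoo R x (x + e) ltac:(lra).
  have [a2] := @rat_in_itvoo R (y - e) y ltac:(lra).
  have [b2] := @rat_in_itvoo R y (y + e) ltac:(lra).
  rewrite !in_itv /= => /andP[? ?] /andP[? ?] /andP[? ?] /andP[? ?].
  exists ((a1, b1), (a2, b2)) => /=; last first.
    by split => /=; rewrite in_itv /=; apply/andP; split.
  move=> [z1 z2] [/=]; rewrite !in_itv /= => /andP[? ?] /andP[? ?]; apply: eA.
  by split; rewrite /= /ball /= ltr_norml; apply/andP; split; lra.
rewrite bigcup_mkcond; apply: countable_bigcupT_measurable => // q.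
by case: ifP => // _; apply: measurableX; exact: measurable_itv.
Qed.

Lemma area_ge_box (R : realType) (A : set (R * R)) (a b c d : R) :
  open A -> a <= b -> c <= d -> `[a, b] `*` `[c, d] `<=` A ->
  (((b - a) * (d - c))%:E <= area A)%E.
Proof.
move=> /open_measurable_prod mA ab cd sA.
have mI (x y : R) : measurable (`[x, y] : set R) by exact: measurable_itv.
have lI (x y : R) : x <= y -> lebesgue_measure (`[x, y] : set R) = (y - x)%:E.
  rewrite lebesgue_measure_itv /= lte_fin le_eqVlt => /orP[/eqP->|->].
    by rewrite ltxx subrr.
  by rewrite EFinB.
rewrite EFinM -(lI _ _ ab) -(lI _ _ cd).
rewrite -(@product_measure1E _ _ _ _ _ lebesgue_measure lebesgue_measure)//.
by apply: le_measure => //; rewrite inE//; exact: measurableX.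
Qed.

(** * Homeomorphisms of the line *)

Lemma expanding_homeo (R : realType) (f : R -> R) (k : R) :
    0 < k -> continuous f ->
    (forall x y, x <= y -> k * (y - x) <= f y - f x) ->
  exists g, [/\ cancel f g, cancel g f & continuous g].
Proof.
move=> k0 fc fk.
have fabs x y : k * `|x - y| <= `|f x - f y|.
  wlog xy : x y / y <= x.
    move=> H; have [/H//|/ltW/H] := leP y x.
    by rewrite (distrC y) (distrC (f y)).
  rewrite [X in k * X]ger0_norm ?subr_ge0//.
  exact: le_trans (fk _ _ xy) (ler_norm _).
have surj v : exists x, f x = v.
  (* By expansion [f (- a) <= v <= f a], so the intermediate value theorem applies. *)
  pose a := `|v - f 0| / k.
  have a0 : 0 <= a by apply: divr_ge0; [exact: normr_ge0|exact: ltW].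
  have ka : k * a = `|v - f 0| by rewrite /a mulrC mulfVK ?gt_eqF.
  have h1 := fk 0 a a0; have h2 := fk (- a) 0 ltac:(lra).
  have h3 := ler_norm (v - f 0); have h4 := ler_norm (- (v - f 0)).
  rewrite normrN in h4.
  have [] := @IVT R f (- a) a v.
  - lra.
  - exact: continuous_subspaceT.
  - by rewrite ge_min le_max; apply/andP; split; apply/orP; [left|right]; lra.
  by move=> x _ fx; exists x.
have [g gP] := choice surj.
have fg : cancel f g.
  move=> x; apply/eqP; rewrite -subr_eq0 -normr_le0.
  by have := fabs (g (f x)) x; rewrite gP subrr normr0 pmulr_rle0.
exists g; split=> //.
(* The inverse is Lipschitz with constant [1 / k]. *)
move=> y; apply/cvgrPdist_lt => e e0.
near=> z.
have : `|y - z| < k * e.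
  by near: z; apply: cvgr_dist_lt; [exact: cvg_id|exact: mulr_gt0].
rewrite -{1}(gP y) -{1}(gP z) => /(le_lt_trans (fabs _ _)).
by rewrite ltr_pM2l.
Unshelve. all: by end_near.
Qed.

Lemma parab_continuous (R : realType) (a b : R) : continuous (parab a b).
Proof.
by move=> x; apply: cvgM; apply: cvgB; try exact: cvg_cst; exact: cvg_id.
Qed.

(** The maps are increasing, so that acting with one on each axis sends boxes to boxes. *)
Record line_homeo (R : realType) := LineHomeo {
  lh :> R -> R ;
  lh_inv : R -> R ;
  lhK : cancel lh lh_inv ;
  lh_invK : cancel lh_inv lh ;
  lh_le : {mono lh : x y / x <= y} ;
  lh_continuous : continuous lh ;
  lh_inv_continuous : continuous lh_inv
}.

(** * Warped parabolic arcs and their crossings *)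

Section Warp.
Variables (R : realType) (h q : line_homeo R).

Definition warp (z : R * R) : R * R := (h z.1, q z.2).

Definition unwarp (z : R * R) : R * R := (lh_inv h z.1, lh_inv q z.2).

Lemma warpK : cancel warp unwarp.
Proof. by case=> x y; rewrite /unwarp /warp /= !lhK. Qed.

Lemma unwarpK : cancel unwarp warp.
Proof. by case=> x y; rewrite /unwarp /warp /= !lh_invK. Qed.

Lemma warp_continuous : continuous warp.
Proof.
apply: continuous_pair => z; apply: continuous_comp.
- exact: cvg_fst.
- exact: lh_continuous.
- exact: cvg_snd.
- exact: lh_continuous.
Qed.

Lemma unwarp_continuous : continuous unwarp.
Proof.
apply: continuous_pair => z; apply: continuous_comp.
- exact: cvg_fst.
- exact: lh_inv_continuous.
- exact: cvg_snd.
- exact: lh_inv_continuous.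
Qed.

Definition arc (a b t : R) : R * R :=
  warp (a + t * (b - a), t * (1 - t) * (b - a) ^+ 2).

(** A parameter-free description of the closed arc: a nonnegative ordinate already confines the
    abscissa between the feet. *)
Definition arc_set (a b : R) : set (R * R) :=
  [set z | (unwarp z).2 = parab a b (unwarp z).1 /\ 0 <= (unwarp z).2].

Lemma arc_continuous (a b : R) : continuous (arc a b).
Proof.
move=> t; apply: continuous_comp; last exact: warp_continuous.
apply: continuous_pair => s.
  by apply: cvgD; [exact: cvg_cst|apply: cvgM; [exact: cvg_id|exact: cvg_cst]].
apply: cvgM; last exact: cvg_cst.
by apply: cvgM; [exact: cvg_id|apply: cvgB; [exact: cvg_cst|exact: cvg_id]].
Qed.

Lemma arc_rev (a b t : R) : arc b a t = arc a b (1 - t).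
Proof. by rewrite /arc; congr (warp (_, _)); ring. Qed.

Lemma arc0 (a b : R) : arc a b 0 = warp (a, 0).
Proof. by rewrite /arc; congr (warp (_, _)); ring. Qed.

Lemma arc1 (a b : R) : arc a b 1 = warp (b, 0).
Proof. by rewrite /arc; congr (warp (_, _)); ring. Qed.

Lemma arc_set_closed (a b : R) : closed (arc_set a b).
Proof.
have -> : arc_set a b =
    (fun z => (unwarp z).2 - parab a b (unwarp z).1) @^-1` [set 0] `&`
    (fun z => (unwarp z).2) @^-1` [set y | 0 <= y].
  apply/seteqP; split=> z [z1 z2]; split => //.
    by change ((unwarp z).2 - parab a b (unwarp z).1 = 0); rewrite z1 subrr.
  by apply/eqP; rewrite -subr_eq0; apply/eqP.
have c1 : continuous (fun z => (unwarp z).1).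
  move=> z; apply: (@continuous_comp _ _ _ unwarp fst).
  - exact: unwarp_continuous.
  - exact: cvg_fst.
have c2 : continuous (fun z => (unwarp z).2).
  move=> z; apply: (@continuous_comp _ _ _ unwarp snd).
  - exact: unwarp_continuous.
  - exact: cvg_snd.
apply: closedI; apply: preimage_closed.
- move=> z _; apply: cvgB; first exact: c2.
  apply: (@continuous_comp _ _ _ (fun z => (unwarp z).1) (parab a b)).
    exact: c1.
  exact: parab_continuous.
- exact: closed_eq.
- by move=> z _; exact: c2.
- exact: closed_ge.
Qed.

Lemma arc_inj (a b : R) : a != b -> injective (arc a b).
Proof.
move=> ab s t /(can_inj warpK)[/addrI st _].
by apply: mulIf st; rewrite subr_eq0 eq_sym.
Qed.

Lemma unwarp_arc (a b t : R) :
  unwarp (arc a b t) = (a + t * (b - a), parab a b (a + t * (b - a))).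
Proof. by rewrite /arc warpK parab_param. Qed.

Lemma arcK (a b : R) z : a != b -> (unwarp z).2 = parab a b (unwarp z).1 ->
  arc a b (((unwarp z).1 - a) / (b - a)) = z.
Proof.
move=> ab zE; apply: (can_inj unwarpK); rewrite unwarp_arc.
rewrite mulfVK ?subr_eq0 1?eq_sym// subrKC.
by rewrite [RHS]surjective_pairing zE.
Qed.

Lemma arc_image (a b : R) : a != b -> arc a b @` `[0, 1] = arc_set a b.
Proof.
move=> ab; apply/seteqP; split=> [_ [t /= t01 <-]|z [zE z0]].
  split; rewrite unwarp_arc //= parab_param.
  move: t01; rewrite in_itv /= => /andP[t0 t1].
  by rewrite mulr_ge0 ?sqr_ge0// mulr_ge0 ?subr_ge0.
have := arcK ab zE; set t := _ / _ => tE; exists t => //=.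
move: z0; rewrite -tE unwarp_arc parab_param /= pmulr_lge0; last first.
  by rewrite exprn_even_gt0//= subr_eq0 eq_sym.
by rewrite in_itv /= => tt; apply/andP; split; nra.
Qed.

Lemma arc_interior (a b : R) : a != b ->
  arc a b @` `]0, 1[ = [set z | arc_set a b z /\ 0 < (unwarp z).2].
Proof.
move=> ab; apply/seteqP; split=> [_ [t /= t01 <-]|z [[zE _] z0]].
  move: t01; rewrite in_itv /= => /andP[t0 t1].
  have p0 : 0 < (unwarp (arc a b t)).2.
    rewrite unwarp_arc parab_param /=; apply: mulr_gt0.
      by rewrite mulr_gt0 ?subr_gt0.
    by rewrite exprn_even_gt0//= subr_eq0 eq_sym.
  by split => //; split; [rewrite unwarp_arc|exact: ltW].
have := arcK ab zE; set t := _ / _ => tE; exists t => //=.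
move: z0; rewrite -tE unwarp_arc parab_param /= pmulr_lgt0; last first.
  by rewrite exprn_even_gt0//= subr_eq0 eq_sym.
by rewrite in_itv /= => tt; apply/andP; split; nra.
Qed.

(** The functions [y - parab c d x] and [y - parab a b x] serve as local coordinates: their
    difference is affine in [x] with nonzero slope [m], so [x] and then [y] can be recovered from
    them. *)
Lemma arc_cross (a b c d : R) z :
    arc_set a b z -> arc_set c d z -> 0 < (unwarp z).2 ->
    ~ parab a b =1 parab c d ->
  properly_cross_at (arc_set a b) (arc_set c d) z.
Proof.
move=> [zab _] [zcd _] z0 ne.
move: zab zcd z0; set x0 := (unwarp z).1; set y0 := (unwarp z).2 => zab zcd z0.
set m := a + b - c - d.
have mE x : parab a b x - parab c d x = m * (x - x0).
  have := parab_sub a b c d x; have := parab_sub a b c d x0.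
  by rewrite -zab -zcd subrr => e0 ->; rewrite /m; move: e0; lra.
have m0 : m != 0.
  apply/eqP => m0; apply: ne => x; apply/eqP.
  by rewrite -subr_eq0 mE m0 mul0r.
(* Both parabolas are positive at [x0]; within distance [r] the nonnegativity demanded by [arc_set]
   is then automatic. *)
have [r r0 rP] : exists2 r, 0 < r &
    forall x, `|x - x0| < r -> 0 <= parab a b x /\ 0 <= parab c d x.
  have pos u v : 0 < parab u v x0 -> \forall x \near x0, 0 <= parab u v x.
    move=> p0; near=> x; apply: ltW; near: x.
    exact: (cvgr_gt (parab u v x0) (@parab_continuous R u v x0)).
  have : \forall x \near x0, 0 <= parab a b x /\ 0 <= parab c d x.
    by apply: filterI; apply: pos; rewrite -?zab -?zcd.
  case/nbhs_ballP => r /= r0 rP; exists r => // x xr; apply: rP.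
  by rewrite /ball /= distrC.
(* With this scale the preimages of the axes of the open square have abscissa within [r] of [x0]: on
   an axis [|u.1 - u.2| < 1], and [|e / m| = r]. *)
pose e := r * `|m|.
have e0 : 0 < e by rewrite mulr_gt0// normr_gt0.
have e1 : e != 0 by rewrite gt_eqF.
pose F (u : R * R) := ((u.2 - parab c d u.1) / e, (u.2 - parab a b u.1) / e).
pose X (u : R * R) := x0 + (u.1 - u.2) * (e / m).
pose G (u : R * R) := (X u, parab a b (X u) + u.2 * e).
have FK : cancel F G.
  move=> [x y]; have XE : X (F (x, y)) = x.
    rewrite /X /F /=; have -> : (y - parab c d x) / e - (y - parab a b x) / e =
      m * (x - x0) / e by rewrite -mE; ring.
    by field; rewrite ?e1 ?m0.
  by rewrite /G XE /F /= mulfVK// subrKC.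
have GK : cancel G F.
  move=> [u v]; rewrite /F /G /=.
  have -> : parab c d (X (u, v)) = parab a b (X (u, v)) - m * (X (u, v) - x0).
    by rewrite -mE subKr.
  have -> : X (u, v) - x0 = (u - v) * (e / m) by rewrite /X /= addrC addKr.
  by congr (_, _); field; rewrite ?e1 ?m0.
have Xc : continuous X.
  move=> u; apply: cvgD; first exact: cvg_cst.
  apply: cvgM; last exact: cvg_cst.
  by apply: cvgB; [exact: cvg_fst|exact: cvg_snd].
have Fc : continuous F.
  have Fic s t : continuous (fun u : R * R => (u.2 - parab s t u.1) / e).
    move=> u; apply: cvgM; last exact: cvg_cst.
    apply: cvgB; first exact: cvg_snd.
    by apply: continuous_comp; [exact: cvg_fst|exact: parab_continuous].
  by apply: continuous_pair; exact: Fic.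
have Gc : continuous G.
  apply: continuous_pair => // u; apply: cvgD.
    by apply: continuous_comp; [exact: Xc|exact: parab_continuous].
  by apply: cvgM; [exact: cvg_snd|exact: cvg_cst].
pose f := F \o unwarp; pose g := warp \o G.
have fc : continuous f.
  by move=> u; apply: continuous_comp; [exact: unwarp_continuous|exact: Fc].
have gc : continuous g.
  by move=> u; apply: continuous_comp; [exact: Gc|exact: warp_continuous].
have fK : cancel f g by move=> u; rewrite /f /g /= FK unwarpK.
have gK : cancel g f by move=> u; rewrite /f /g /= warpK GK.
have fz : f z = (0, 0).
  by rewrite /f /F /= -/x0 -/y0 -zab -zcd subrr mul0r.
have osq : open (@open_square R).
  have -> : @open_square R = fst @^-1` `]-1, 1[ `&` snd @^-1` `]-1, 1[.
    by apply/seteqP; split=> u; rewrite /open_square /= !in_itv.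
  apply: openI; apply: open_comp; try exact: interval_open.
    by move=> u _; exact: cvg_fst.
  by move=> u _; exact: cvg_snd.
have Xr u : open_square u -> u.1 = 0 \/ u.2 = 0 -> `|X u - x0| < r.
  move=> [/andP[? ?] /andP[? ?]] u0.
  have -> : X u - x0 = (u.1 - u.2) * (e / m) by rewrite /X addrC addKr.
  have em : `|e / m| = r.
    by rewrite normrM normfV (gtr0_norm e0) /e mulfK// normr_eq0.
  rewrite normrM em gtr_pMl// ltr_norml; apply/andP.
  by case: u0 => ->; split; lra.
exists (f @^-1` @open_square R), f, g; split=> //.
- split; first by apply: open_comp => // u _; exact: fc.
  by rewrite /= fz /open_square /=; split; apply/andP; split; lra.
- split.
  + split=> //; first by move=> u v _ _; exact: (can_inj fK).
    by move=> u su; exists (g u); rewrite /= gK.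
  + by move=> u _; exact: fK.
  + exact: continuous_subspaceT.
  + exact: continuous_subspaceT.
- apply/seteqP; split=> [_ [u [[uE _] su] <-]|u [su u2]].
    by split=> //; rewrite /f /comp /F uE /= subrr mul0r.
  exists (g u); last exact: gK.
  split; last by rewrite /= gK.
  split; rewrite /g /comp warpK /= u2 mul0r addr0 //.
  by have [] := rP (X u) (Xr u su (or_intror u2)).
- apply/seteqP; split=> [_ [u [[uE _] su] <-]|u [su u1]].
    by split=> //; rewrite /f /comp /F uE /= subrr mul0r.
  exists (g u); last exact: gK.
  split; last by rewrite /= gK.
  have yE : parab a b (X u) + u.2 * e = parab c d (X u).
    have := mE (X u); have -> : X u - x0 = - u.2 * (e / m).
      by rewrite /X addrC addKr u1 sub0r.
    have -> : m * (- u.2 * (e / m)) = - (u.2 * e) by field.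
    lra.
  have gE : unwarp (g u) = G u by rewrite /g /comp warpK.
  split; rewrite gE /= yE //.
  by have [] := rP (X u) (Xr u su (or_introl u1)).
Unshelve. all: by end_near.
Qed.

End Warp.

Lemma convex_gt0 (R : realType) (a b t : R) : 0 <= t <= 1 -> 0 < a -> 0 < b ->
  0 < (1 - t) * a + t * b.
Proof.
move=> /andP[t0 t1] a0 b0; have [ab|ba] := leP a b.
  have : 0 <= t * (b - a) by rewrite mulr_ge0//; lra.
  lra.
have : 0 <= (1 - t) * (a - b) by rewrite mulr_ge0//; lra.
lra.
Qed.

(** * The drawing of the complete graph *)

Section Drawing.
Variables (R : realType) (n : nat) (h q : line_homeo R).

Definition pt (u : 'I_n) : R := (u : nat)%:R.

Lemma pt_inj : injective pt.
Proof. by move=> u v /eqP; rewrite /pt eqr_nat => /eqP/val_inj. Qed.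

Lemma pt_neq u v : u != v -> pt u != pt v.
Proof. by rewrite (inj_eq pt_inj). Qed.

Lemma pt_ge0 u : 0 <= pt u.
Proof. exact: ler0n. Qed.

Lemma pt_le u : pt u <= n%:R - 1.
Proof. by rewrite lerBrDr /pt natr1 ler_nat. Qed.

(** Lets the distinctness of edges, a condition on unordered pairs of vertices, be read on the
    parabolas. *)
Lemma parab_pt (a b c d : 'I_n) :
  parab (pt a) (pt b) =1 parab (pt c) (pt d) <-> [set a; b]%SET = [set c; d]%SET.
Proof.
split=> [/parab_inj[] [/pt_inj-> /pt_inj->] //|/setP e]; first by rewrite finset.setUC.
have [ab|ab] := eqVneq a b.
  have := e c; have := e d; rewrite ab !inE !eqxx ?orbT !orbb.
  by move=> /eqP-> /eqP-> x.
have := e a; have := e b; rewrite !inE !eqxx ?orbT /=.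
move=> /esym/orP[]/eqP be /esym/orP[]/eqP ae x; rewrite ae be //.
- by move: ab; rewrite ae be eqxx.
- exact: parabC.
- by move: ab; rewrite ae be eqxx.
Qed.

Let adj : rel 'I_n := fun u v => u != v.
Let pos (u : 'I_n) : R * R := warp h q (pt u, 0).
Let earc (u v : 'I_n) : R -> R * R := arc h q (pt u) (pt v).

Let adj_sym : symmetric adj.
Proof. by move=> u v; rewrite /adj eq_sym. Qed.

Let adj_irrefl : irreflexive adj.
Proof. by move=> u; rewrite /adj eqxx. Qed.

Let pos_inj : injective pos.
Proof. by move=> u v /(can_inj (@warpK R h q))[/pt_inj]. Qed.

Let earc_rev u v : adj u v ->
  forall t : R, t \in `[0, 1] -> earc v u t = earc u v (1 - t).
Proof. by move=> _ t _; exact: arc_rev. Qed.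

Let earc_continuous u v : adj u v -> {within `[0, 1], continuous (earc u v)}.
Proof. by move=> _; apply: continuous_subspaceT; exact: arc_continuous. Qed.

Let earc_inj u v : adj u v -> set_inj `[0, 1] (earc u v).
Proof. by move=> uv s t _ _; apply: arc_inj; exact: pt_neq. Qed.

Let earc0 u v : adj u v -> earc u v 0 = pos u.
Proof. by move=> _; exact: arc0. Qed.

Let earc1 u v : adj u v -> earc u v 1 = pos v.
Proof. by move=> _; exact: arc1. Qed.

Let earc_avoid u v : adj u v ->
  forall (w : 'I_n) (t : R), t \in `]0, 1[ -> earc u v t <> pos w.
Proof.
move=> uv w t t01 e.
have : (earc u v @` `]0, 1[) (earc u v t) by exists t.
by rewrite /earc arc_interior ?pt_neq// -/(earc u v t) e /= => -[_]; rewrite lhK ltxx.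
Qed.

Let earc_cross u v x y : adj u v -> adj x y ->
  [set u; v]%SET != [set x; y]%SET ->
  forall p, (earc u v @` `]0, 1[) p -> (earc x y @` `]0, 1[) p ->
  properly_cross_at (earc u v @` `[0, 1]) (earc x y @` `[0, 1]) p.
Proof.
move=> uv xy ne p; rewrite /earc !arc_interior ?arc_image ?pt_neq//.
move=> [pu p0] [px _]; apply: arc_cross => //.
by move/parab_pt/eqP; rewrite (negbTE ne).
Qed.

Definition drawing : topological_graph R 'I_n :=
  TopologicalGraph adj_sym adj_irrefl pos_inj earc_rev earc_continuous earc_inj
    earc0 earc1 earc_avoid earc_cross.

Lemma edge_curveE u v :
  u != v -> edge_curve drawing u v = arc_set h q (pt u) (pt v).
Proof. by move=> uv; rewrite /edge_curve /= arc_image// pt_neq. Qed.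

Lemma edge_interiorE u v : u != v -> edge_interior drawing u v =
  [set z | arc_set h q (pt u) (pt v) z /\ 0 < (unwarp h q z).2].
Proof. by move=> uv; rewrite /edge_interior /= arc_interior// pt_neq. Qed.

Lemma drawing_complete : complete_graph drawing.
Proof. by []. Qed.

(** Two common points with the same abscissa have the same ordinate; with different abscissae they
    would force the parabolas, hence the edges, to be equal. *)
Lemma drawing_simple : simple_drawing drawing.
Proof.
move=> u v x y uv xy ne p r; rewrite !edge_curveE// => -[[pu _] [px _]] [[ru _] [rx _]].
apply: (can_inj (@unwarpK R h q)).
have [e|e] := eqVneq (unwarp h q p).1 (unwarp h q r).1.
  by rewrite [LHS]surjective_pairing [RHS]surjective_pairing pu ru e.
have := @parab_meet_once R (pt u) (pt v) (pt x) (pt y) _ _ _ _ e.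
rewrite -pu -px -ru -rx => /(_ erefl erefl)/parab_pt/eqP.
by rewrite (negbTE ne).
Qed.

(** * Every face contains the cell of some vertex *)

Section Face.
Variables (c : seq 'I_n) (p0 : R * R).
Hypothesis plane_c : plane_subgraph drawing (cycle_edge c).
Hypothesis adj_c : forall u, u \in c -> u != next c u.

Let K := cycle_curve drawing c.
Let F := connected_component (~` K) p0.
Let f (u : 'I_n) : R -> R := parab (pt u) (pt (next c u)).

Let KP z : K (warp h q z) <-> exists2 u, u \in c & z.2 = f u z.1 /\ 0 <= z.2.
Proof.
split=> [[u /= uc]|[u uc uz]].
  by rewrite edge_curveE ?adj_c// /arc_set /= !lhK => uz; exists u.
exists u => //=; rewrite edge_curveE ?adj_c//.
by rewrite /arc_set /= !lhK.
Qed.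

Lemma cycle_curve_closed : closed K.
Proof.
rewrite /K /cycle_curve; apply: closed_bigcup => [|u uc].
  exact: finite_finset.
by rewrite edge_curveE ?adj_c//; exact: arc_set_closed.
Qed.

Lemma face_open : open F.
Proof. exact/open_component_prod/closed_openC/cycle_curve_closed. Qed.

(** In this drawing a common interior point of distinct edges is always a proper crossing, which
    planarity of the cycle forbids. *)
Let noncrossing u v z : u \in c -> v \in c -> f u z = f v z -> 0 < f u z ->
  f u =1 f v.
Proof.
move=> uc vc e pz; apply/parab_pt; apply/eqP; apply: contrapT => /negP ne.
have eu : cycle_edge c u (next c u) by rewrite /cycle_edge /= uc eqxx.
have ev : cycle_edge c v (next c v) by rewrite /cycle_edge /= vc eqxx.
apply: (plane_c eu ev ne).
have iu : edge_interior drawing u (next c u) (warp h q (z, f u z)).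
  rewrite edge_interiorE ?adj_c//=.
  by rewrite /arc_set /= !lhK; split => //; split => //; exact: ltW.
have iv : edge_interior drawing v (next c v) (warp h q (z, f u z)).
  rewrite edge_interiorE ?adj_c//=.
  by rewrite /arc_set /= !lhK; split => //; split => //; exact: ltW.
exists (warp h q (z, f u z)); split => //.
by apply: (tg_arc_cross (t0 := drawing)) => //=; exact: adj_c.
Qed.

Let face_path (g : R -> R * R) : continuous g -> F (warp h q (g 0)) ->
  (forall t, 0 <= t <= 1 -> ~ K (warp h q (g t))) -> F (warp h q (g 1)).
Proof.
move=> gc F0 gK; apply: connected_component_trans F0 _.
apply: (@path_connected_component R _ _ (warp h q \o g)) => // t.
by apply: continuous_comp; [exact: gc|exact: warp_continuous].
Qed.

Let face_segment (x y x' y' : R) : F (warp h q (x, y)) ->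
  (forall t, 0 <= t <= 1 ->
    ~ K (warp h q (x + t * (x' - x), y + t * (y' - y)))) ->
  F (warp h q (x', y')).
Proof.
move=> Fx gK.
pose g (t : R) := (x + t * (x' - x), y + t * (y' - y)).
have -> : (x', y') = g 1 by rewrite /g !mul1r !subrKC.
apply: face_path => //; last by rewrite /g !mul0r !addr0.
by apply: continuous_pair => t; apply: cvgD; try exact: cvg_cst;
  apply: cvgM; try exact: cvg_cst; exact: cvg_id.
Qed.

Let vertical_bound (x : R) : bounded_set F ->
  exists2 M, 0 < M & forall y, F (warp h q (x, y)) -> `|q y| <= M.
Proof.
move=> /pinfty_ex_gt0[M M0 FM]; exists M => // y Fy.
have /= := FM _ Fy; rewrite prod_normE /= => /(le_trans _); apply.
by rewrite le_max lexx orbT.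
Qed.

(** Otherwise the face could be followed vertically up to a height where [q] exceeds its bound
    [M]. *)
Let upper_edge (x y : R) : bounded_set F -> F (warp h q (x, y)) ->
  exists2 u, u \in c & y < f u x.
Proof.
move=> /(vertical_bound x)[M M0 FM] Fxy; apply: contrapT => noup.
pose y' := Num.max y (lh_inv q (M + 1)).
have yy' : y <= y' by rewrite le_max lexx.
have : F (warp h q (x, y')).
  apply: (face_segment Fxy) => t /andP[t0 t1]; rewrite subrr mulr0 addr0.
  move=> /KP[u uc /= [uy u0]]; have [yu|uy'] := ltP y (f u x).
    by apply: noup; exists u.
  (* Going up, an edge of height at most [y] can only be met at the starting point, which lies off
     the cycle. *)
  have yE : y + t * (y' - y) = y.
    apply/eqP; rewrite eq_le {1}uy uy' /= lerDl mulr_ge0//; lra.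
  apply: (connected_component_sub Fxy); apply/KP; exists u => //=.
  by rewrite -[y]yE.
move=> /FM; have : M + 1 <= q y' by rewrite -[leLHS](lh_invK q) lh_le le_max lexx orbT.
by have := ler_norm (q y'); lra.
Qed.

Let lower_edge (x y : R) : bounded_set F -> F (warp h q (x, y)) ->
  exists2 u, u \in c & 0 <= f u x < y.
Proof.
move=> /(vertical_bound x)[M M0 FM] Fxy; apply: contrapT => nolow.
pose y' := Num.min y (lh_inv q (- (M + 1))).
have yy' : y' <= y by rewrite ge_min lexx.
have : F (warp h q (x, y')).
  apply: (face_segment Fxy) => t /andP[t0 t1]; rewrite subrr mulr0 addr0.
  move=> /KP[u uc /= [uy u0]]; have [yu|uy'] := ltP (f u x) y.
    by apply: nolow; exists u => //; rewrite -uy u0 uy.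
  have yE : y + t * (y' - y) = y.
    apply/eqP; rewrite eq_le {2}uy uy' andbT gerDl.
    by rewrite mulr_ge0_le0//; lra.
  apply: (connected_component_sub Fxy); apply/KP; exists u => //=.
  by rewrite -[y]yE.
move=> /FM; have : q y' <= - (M + 1).
  by rewrite -[leRHS](lh_invK q) lh_le ge_min lexx orbT.
by have := ler_norm (- q y'); rewrite normrN; lra.
Qed.

(** The face is open, so one of its points can be moved slightly to the right, off the finitely many
    verticals through vertices. *)
Let generic_point : F !=set0 ->
  exists x y, F (warp h q (x, y)) /\ forall u, x != pt u.
Proof.
case=> z Fz; pose x0 := (unwarp h q z).1; pose y := (unwarp h q z).2.
have nearF : \forall x \near x0, F (warp h q (x, y)).
  have cx : {for x0, continuous (fun x : R => warp h q (x, y))}.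
    apply: (@continuous_comp _ _ _ (fun x : R => (x, y)) (warp h q)).
      by apply: continuous_pair => ?; [exact: cvg_id|exact: cvg_cst].
    exact: warp_continuous.
  have nF : nbhs (warp h q (x0, y)) F.
    apply: open_nbhs_nbhs; split; first exact: face_open.
    by rewrite -surjective_pairing unwarpK.
  exact: (cx F nF).
have : \forall x \near x0^'+, F (warp h q (x, y)) /\ forall u, x != pt u.
  apply: filterI; first exact: cvg_within nearF.
  apply: (@filter_forall _ _ (fun u => [set x | x != pt u]) x0^'+ _) => u; have [ux|xu] := leP (pt u) x0.
    near=> x; rewrite /= gt_eqF//; apply: le_lt_trans ux _; near: x.
    exact: nbhs_right_gt.
  by near=> x; rewrite /= lt_eqF.
by case/(@filter_ex _ _ (at_right_proper_filter x0)) => x [Fx xu]; exists x, y.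
Unshelve. all: by end_near.
Qed.

Lemma parab_pt_int u v w : exists m : int, parab (pt u) (pt v) (pt w) = m%:~R.
Proof.
exists (((w : nat)%:Z - (u : nat)%:Z) * ((v : nat)%:Z - (w : nat)%:Z)).
by rewrite /parab /pt intrM !intrB.
Qed.

Lemma parab_pt_gt0 u v w :
  0 < parab (pt u) (pt v) (pt w) -> 1 <= parab (pt u) (pt v) (pt w).
Proof. by have [m ->] := parab_pt_int u v w; rewrite ltr0z ler1z. Qed.

Lemma parab_pt_lt0 u v w :
  parab (pt u) (pt v) (pt w) < 0 -> parab (pt u) (pt v) (pt w) <= -1.
Proof.
have [m ->] := parab_pt_int u v w; rewrite ltrz0 => m0.
by rewrite -[X in _ <= X]/((-1)%:~R) ler_int -ltzD1.
Qed.

(** Expand at the vertex: the value there is an integer, the linear term is below 1/4 in absolute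
    value and the quadratic one at most 1/64, so the height near [w] is either below 1/4 or above
    1/2. *)
Lemma cell_avoid u v w (x : R) : `|x - pt w| <= (8 * n%:R)^-1 ->
  ~~ (4^-1 <= parab (pt u) (pt v) x <= 2^-1).
Proof.
move=> xw; apply/negP => /andP[lo hi].
set d := x - pt w in xw; pose s := pt u + pt v - 2 * pt w.
have fE : parab (pt u) (pt v) x = parab (pt u) (pt v) (pt w) + d * s - d ^+ 2.
  by rewrite /parab /d /s; ring.
have n1 : 1 <= n%:R :> R by have := pt_ge0 w; have := pt_le w; lra.
have s2 : `|s| < 2 * n%:R.
  rewrite ltr_norml /s.
  have := pt_ge0 u; have := pt_ge0 v; have := pt_ge0 w.
  have := pt_le u; have := pt_le v; have := pt_le w.
  by move=> *; apply/andP; split; lra.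
have e8 : 0 < (8 * n%:R)^-1 :> R by rewrite invr_gt0; lra.
have ds : `|d * s| < 4^-1.
  rewrite normrM; apply: (@le_lt_trans _ _ ((8 * n%:R)^-1 * `|s|)).
    by rewrite ler_wpM2r.
  rewrite -ltr_pdivlMl// invrK; lra.
have d2 : 0 <= d ^+ 2 <= 64^-1.
  rewrite sqr_ge0 /= -real_normK ?num_real//.
  have -> : 64^-1 = 8^-1 ^+ 2 :> R by field.
  rewrite lerXn2r ?nnegrE//.
  apply: le_trans xw _; rewrite lef_pV2 ?posrE//; lra.
case/andP: d2 => d2 d3.
move: ds; rewrite ltr_norml => /andP[ds1 ds2].
have [/parab_pt_lt0 w0|/parab_pt_gt0 w0|w0] := ltgtP (parab (pt u) (pt v) (pt w)) 0; lra.
Qed.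

Lemma face_cell : bounded_set F -> F !=set0 ->
  exists w : 'I_n, forall x y : R, `|x - pt w| <= (8 * n%:R)^-1 ->
    4^-1 <= y <= 2^-1 -> F (warp h q (x, y)).
Proof.
move=> Fb /generic_point[x [y [Fxy xint]]].
have nK : ~ K (warp h q (x, y)) by exact: connected_component_sub Fxy.
have [u uc uy] := lower_edge Fb Fxy.
have [||||||i [j [w0 [[ic jc] [/andP[ix iy] jy] wE jw strip]]]] :=
  @noncrossing_strip R 'I_n (mem c) pt (fun u => pt (next c u)) x y.
- exact: noncrossing.
- move=> k kc; apply/eqP => /parab_eq0[] xE.
    by have := xint k; rewrite xE eqxx.
  by have := xint (next c k); rewrite xE eqxx.
- move=> k kc k0; apply/eqP => ky; apply: nK; apply/KP; exists k => //=.
  by rewrite -ky.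
- by exists u.
- have [v vc vy] := upper_edge Fb Fxy; by exists v.
- by case/andP: uy; exact: le_lt_trans.
rewrite -!/(f _) in ix iy jy jw strip.
have [w wE'] : exists w, w0 = pt w.
  by case: wE => ->; [exists i|exists (next c i)].
have fiw : f i w0 = 0.
  by case: wE => ->; [exact: parab_l|exact: parab_r].
rewrite wE' {wE} in jw fiw; clear w0 wE'.
(* By integrality the upper edge has height at least 1 over [w], so height 1/2 lies inside the
   strip. *)
have jw1 : 1 <= f j (pt w) by exact: parab_pt_gt0.
(* The quadratic terms cancel in the thickness [D] of the strip, which is thus affine and positive
   from [x] to [pt w]. *)
pose D (z : R) := f j z - f i z.
have Dconv t : D (x + t * (pt w - x)) = (1 - t) * D x + t * D (pt w).
  by rewrite /D /f !parab_conv; ring.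
have Dx : 0 < D x by rewrite /D; lra.
have Dw : 1 <= D (pt w) by rewrite /D fiw; lra.
(* Relative heights in the strip of the starting point and of the point at height 1/2 above [w]. The
   path [g] interpolates between them and so stays strictly between the two edges. *)
pose s0 := (y - f i x) / D x; pose s1 := (2 * D (pt w))^-1.
have s01 : 0 < s0 < 1.
  apply/andP; split; first by rewrite divr_gt0// subr_gt0.
  by rewrite ltr_pdivrMr// mul1r /D; lra.
have s11 : 0 < s1 < 1.
  rewrite /s1 invr_gt0; apply/andP; split; first lra.
  by rewrite invf_lt1; lra.
pose g (t : R) := (x + t * (pt w - x),
  f i (x + t * (pt w - x)) + (s0 + t * (s1 - s0)) * D (x + t * (pt w - x))).
have g0 : g 0 = (x, y).
  rewrite /g !mul0r !addr0 /s0 mulfVK ?gt_eqF// subrKC//.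
have g1 : g 1 = (pt w, 2^-1).
  rewrite /g !mul1r !subrKC fiw add0r /s1; congr (_, _); field.
  by rewrite gt_eqF//; lra.
have Fw : F (warp h q (pt w, 2^-1)).
  rewrite -g1; apply: face_path; last 2 first.
  - by rewrite g0.
  - move=> t /andP[t0 t1] /KP[k kc]; rewrite /g; set z := x + t * _ => /= -[zE z0].
    have Dz : 0 < D z.
      by rewrite Dconv convex_gt0 ?t0//; lra.
    (* Concavity keeps the lower edge nonnegative between [x] and its foot. *)
    have iz : 0 <= f i z.
      rewrite /z /f parab_conv -!/(f i _) fiw mulr0 addr0 addr_ge0//.
        by rewrite mulr_ge0//; lra.
      by rewrite mulr_ge0 ?sqr_ge0// mulr_ge0//; lra.
    have st : 0 < s0 + t * (s1 - s0) < 1.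
      case/andP: s01 => s0_gt0 s0_lt1; case/andP: s11 => s1_gt0 s1_lt1.
      have t01 : 0 <= t <= 1 by rewrite t0.
      have := convex_gt0 t01 s0_gt0 s1_gt0.
      have := @convex_gt0 _ (1 - s0) (1 - s1) _ t01.
      by rewrite !subr_gt0 => /(_ s0_lt1 s1_lt1) *; apply/andP; split; lra.
    case/andP: st => st0 st1.
    have := strip k z kc iz; rewrite -!/(f _ z) -zE => /(_ z0)/negP; apply.
    rewrite ltrDl mulr_gt0//=.
    have : (s0 + t * (s1 - s0)) * D z < D z by rewrite gtr_pMl.
    by rewrite {2}/D; lra.
  have Xc : continuous (fun t : R => x + t * (pt w - x)).
    by move=> t; apply: cvgD; [exact: cvg_cst|
      apply: cvgM; [exact: cvg_id|exact: cvg_cst]].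
  have fc k : continuous (fun t : R => f k (x + t * (pt w - x))).
    move=> t; apply: (@continuous_comp _ _ _ (fun t : R => x + t * (pt w - x)) (f k)).
      exact: Xc.
    exact: parab_continuous.
  apply: continuous_pair => // t; apply: cvgD; first exact: fc.
  apply: cvgM; last by apply: cvgB; exact: fc.
  by apply: cvgD; [exact: cvg_cst|apply: cvgM; [exact: cvg_id|exact: cvg_cst]].
(* The cell is convex and contains the point at height 1/2 above [w], and no edge enters it. *)
exists w => x' y' xw yb; apply: (face_segment Fw) => t /andP[t0 t1].
move=> /KP[k kc /= [kE _]].
have : `|(pt w + t * (x' - pt w)) - pt w| <= (8 * n%:R)^-1.
  rewrite addrC addKr normrM ger0_norm//; apply: le_trans xw.
  by rewrite -[leRHS]mul1r ler_wpM2r.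
move/(cell_avoid k (next c k))/negP; apply.
rewrite -/(f k _) -kE; case/andP: yb => *; apply/andP; split; nra.
Qed.

End Face.

End Drawing.

Lemma expanding_line_homeo (R : realType) (f : R -> R) (k : R) :
    0 < k -> continuous f ->
    (forall x y, x <= y -> k * (y - x) <= f y - f x) ->
  exists h : line_homeo R, lh h = f.
Proof.
move=> k0 fc fk; have [g [fg gf gc]] := expanding_homeo k0 fc fk.
suff fle : {mono f : x y / x <= y} by exists (LineHomeo fg gf fle fc gc).
apply: le_mono => x y xy; rewrite -subr_gt0.
by apply: lt_le_trans (fk _ _ (ltW xy)); rewrite mulr_gt0// subr_gt0.
Qed.

(** * Stretching the axes to fit the unit square *)

Section Stretch.
Variables (R : realType) (n : nat).
Hypothesis n_gt0 : (0 < n)%N.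

Definition clamp (x : R) : R := Num.max 0 (Num.min x 1).

Lemma clamp_ge0 x : 0 <= clamp x.
Proof. by rewrite /clamp le_max lexx. Qed.

Lemma clamp_le1 x : clamp x <= 1.
Proof. by rewrite /clamp ge_max ler01 ge_min lexx orbT. Qed.

Lemma clamp_le x y : x <= y -> clamp x <= clamp y.
Proof.
move=> xy; rewrite /clamp ge_max le_max lexx /= le_max; apply/orP; right.
by rewrite le_min !ge_min xy lexx orbT.
Qed.

Lemma continuous_clamp : continuous clamp.
Proof.
move=> x; apply: (@continuous_max R R (fun=> 0) (fun x => Num.min x 1)).
  exact: cvg_cst.
by apply: (@continuous_min R R id (fun=> 1)); [exact: cvg_id|exact: cvg_cst].
Qed.

Local Notation N := (n%:R : R).

Let N_ge1 : 1 <= N.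
Proof. by rewrite ler1n. Qed.

(* Each point [i < n] has a neighbourhood of radius [1 / 8n] that is stretched
   to length at least [1 / 2n], while the total length stays bounded. *)
Definition hstretch (x : R) : R :=
  (x + \sum_(i < n) clamp (4 * N * (x - (i : nat)%:R) + 2^-1)) / (2 * N).

(** The slope is at least 1/2 below height 1, where the cells lie; the term [y / N ^+ 2] keeps the
    map expanding above, and adds at most 1 up to height [N ^+ 2], which bounds all arcs. *)
Definition vstretch (y : R) : R := (Num.min y 1 + y / N ^+ 2) / 2.

Lemma hstretch_expanding x y : x <= y ->
  (2 * N)^-1 * (y - x) <= hstretch y - hstretch x.
Proof.
move=> xy; have N1 := N_ge1; rewrite /hstretch -mulrBl mulrC ler_wpM2r ?invr_ge0//.
rewrite opprD addrACA lerDl subr_ge0; apply: ler_sum => i _.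
by apply: clamp_le; rewrite lerD2r ler_wpM2l//; lra.
Qed.

Lemma hstretch_continuous : continuous hstretch.
Proof.
move=> x; apply: cvgM; last exact: cvg_cst.
apply: cvgD; first exact: cvg_id.
apply: continuous_big => [|i _ {}x]; first exact: add_continuous.
apply: (@continuous_comp _ _ _ (fun x : R => 4 * N * (x - (i : nat)%:R) + 2^-1) clamp).
  apply: cvgD; last exact: cvg_cst.
  apply: cvgM; first exact: cvg_cst.
  by apply: cvgB; [exact: cvg_id|exact: cvg_cst].
exact: continuous_clamp.
Qed.

(** Across this neighbourhood the clamped term of [w] goes from 0 to 1, and no other term
    decreases. *)
Lemma hstretch_cell (w : 'I_n) :
  (2 * N)^-1 <= hstretch ((w : nat)%:R + (8 * N)^-1) - hstretch ((w : nat)%:R - (8 * N)^-1).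
Proof.
have N1 := N_ge1.
rewrite /hstretch -mulrBl -[leLHS]mul1r ler_wpM2r ?invr_ge0//.
have e8 : 0 < (8 * N)^-1 by rewrite invr_gt0; lra.
rewrite (bigD1 w)//= [X in _ <= _ - (_ + X)](bigD1 w)//=.
have E : 4 * N * (8 * N)^-1 = 2^-1 by field; rewrite gt_eqF//; lra.
have -> : clamp (4 * N * ((w : nat)%:R + (8 * N)^-1 - (w : nat)%:R) + 2^-1) = 1.
  have -> : 4 * N * ((w : nat)%:R + (8 * N)^-1 - (w : nat)%:R) + 2^-1 = 1.
    by rewrite [_ - (w : nat)%:R]addrC addKr E; field.
  by rewrite /clamp minxx max_r.
have -> : clamp (4 * N * ((w : nat)%:R - (8 * N)^-1 - (w : nat)%:R) + 2^-1) = 0.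
  have -> : 4 * N * ((w : nat)%:R - (8 * N)^-1 - (w : nat)%:R) + 2^-1 = 0.
    by rewrite [_ - (w : nat)%:R]addrC addKr mulrN E addNr.
  by rewrite /clamp min_l ?ler01// maxxx.
set s1 := \sum_(i < n | _) _; set s2 := \sum_(i < n | _) _.
have : s2 <= s1.
  apply: ler_sum => i _; apply: clamp_le; rewrite lerD2r ler_wpM2l//; lra.
lra.
Qed.

Lemma hstretch_itv x : 0 <= x <= N - 1 -> 0 <= hstretch x <= 1.
Proof.
have N1 := N_ge1; move=> /andP[x0 x1].
have N0 : 0 < 2 * N by lra.
have s0 : 0 <= \sum_(i < n) clamp (4 * N * (x - (i : nat)%:R) + 2^-1).
  by apply: sumr_ge0 => i _; exact: clamp_ge0.
have s1 : \sum_(i < n) clamp (4 * N * (x - (i : nat)%:R) + 2^-1) <= N.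
  have -> : N = \sum_(i < n) 1 by rewrite sumr_const card_ord.
  by apply: ler_sum => i _; exact: clamp_le1.
rewrite /hstretch divr_ge0 ?addr_ge0// ?(ltW N0)//= ler_pdivrMr// mul1r; lra.
Qed.

Let N2_gt0 : 0 < N ^+ 2.
Proof. by rewrite exprn_gt0//; have := N_ge1; lra. Qed.

Lemma vstretch_expanding x y : x <= y ->
  (2 * N ^+ 2)^-1 * (y - x) <= vstretch y - vstretch x.
Proof.
move=> xy; have m : Num.min x 1 <= Num.min y 1.
  by rewrite le_min !ge_min xy lexx orbT.
have -> : (2 * N ^+ 2)^-1 * (y - x) = (y / N ^+ 2 - x / N ^+ 2) / 2.
  by field; rewrite gt_eqF//; have := N_ge1; lra.
by rewrite /vstretch; lra.
Qed.

Lemma vstretch_continuous : continuous vstretch.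
Proof.
move=> x; apply: cvgM; last exact: cvg_cst.
apply: cvgD; last by apply: cvgM; [exact: cvg_id|exact: cvg_cst].
by apply: (@continuous_min R R id (fun=> 1)); [exact: cvg_id|exact: cvg_cst].
Qed.

Lemma vstretch_cell : 8^-1 <= vstretch 2^-1 - vstretch 4^-1.
Proof.
rewrite /vstretch !min_l; try lra.
have : 4^-1 / N ^+ 2 <= 2^-1 / N ^+ 2 by rewrite ler_pM2r ?invr_gt0//; lra.
lra.
Qed.

Lemma vstretch_itv y : 0 <= y <= N ^+ 2 -> 0 <= vstretch y <= 1.
Proof.
move=> /andP[y0 y1].
have q0 : 0 <= y / N ^+ 2 by rewrite divr_ge0// ltW.
have q1 : y / N ^+ 2 <= 1 by rewrite ler_pdivrMr// mul1r.
have m0 : 0 <= Num.min y 1 by rewrite le_min y0 ler01.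
have m1 : Num.min y 1 <= 1 by rewrite ge_min lexx orbT.
by rewrite /vstretch; apply/andP; split; lra.
Qed.

Lemma drawing_in_square (h q : line_homeo R) : lh h = hstretch -> lh q = vstretch ->
  drawn_in (drawing n h q) (@unit_square R).
Proof.
move=> hE qE.
have sq (x y : R) : 0 <= x <= N - 1 -> 0 <= y <= N ^+ 2 ->
    unit_square (warp h q (x, y)).
  by move=> *; split; rewrite /= ?hE ?qE; [exact: hstretch_itv|exact: vstretch_itv].
split=> [u|u v uv z].
  by apply: sq; rewrite ?pt_ge0 ?pt_le ?lexx ?(ltW N2_gt0).
move=> [t /=]; rewrite in_itv /= => /andP[t0 t1] <-.
have u0 := pt_ge0 R u; have u1 := pt_le R u; have v0 := pt_ge0 R v; have v1 := pt_le R v.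
have t1' : 0 <= 1 - t by lra.
apply: sq.
  have := mulr_ge0 t1' u0; have := mulr_ge0 t0 v0.
  have : t * pt R v <= t * (N - 1) by rewrite ler_wpM2l.
  have : (1 - t) * pt R u <= (1 - t) * (N - 1) by rewrite ler_wpM2l.
  by move=> *; apply/andP; split; lra.
have tt0 : 0 <= t * (1 - t) by rewrite mulr_ge0.
have tt1 : t * (1 - t) <= 1 by have := sqr_ge0 t; rewrite expr2; lra.
have vu : (pt R v - pt R u) ^+ 2 <= N ^+ 2.
  rewrite -(@real_normK _ (pt R v - pt R u)) ?num_real// lerXn2r ?nnegrE//.
  by rewrite ler_norml; apply/andP; split; lra.
rewrite mulr_ge0 ?sqr_ge0//= -[leRHS]mul1r.
by apply: ler_pM => //; exact: sqr_ge0.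
Qed.

End Stretch.

Theorem theorem3 (R : realType) :
  exists c : R, 0 < c /\
    forall n : nat, (1 <= n)%N ->
      exists G : topological_graph R 'I_n,
        [/\ complete_graph G,
            simple_drawing G,
            drawn_in G (@unit_square R) &
            forall (k : nat) (F : set (R * R)), (3 <= k)%N -> kface G k F ->
              ((c / n%:R)%:E <= area F)%E].
Proof.
(* The constant is 1/2 times 1/8: cells are stretched to width at least [1 / (2 n)] and height at
   least 1/8. *)
exists 16^-1; split=> [|n n0]; first lra.
have n1 : 1 <= n%:R :> R by rewrite ler1n.
have [h hE] : exists h : line_homeo R, lh h = hstretch n.
  apply: (@expanding_line_homeo R _ (2 * n%:R)^-1).
  - by rewrite invr_gt0; lra.
  - exact: hstretch_continuous.
  - by move=> x y; exact: hstretch_expanding.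
have [q qE] : exists q : line_homeo R, lh q = vstretch n.
  apply: (@expanding_line_homeo R _ (2 * n%:R ^+ 2)^-1).
  - by rewrite invr_gt0 mulr_gt0// exprn_gt0//; lra.
  - exact: vstretch_continuous.
  - by move=> x y; exact: vstretch_expanding.
exists (drawing n h q); split.
- exact: drawing_complete.
- exact: drawing_simple.
- exact: drawing_in_square.
move=> k F _ [c [_ _ /andP[cyc _] plane] [p [pK -> bF]]].
have adj u : u \in c -> u != next c u by move=> uc; exact: next_cycle cyc uc.
have F0 : connected_component (~` cycle_curve (drawing n h q) c) p !=set0.
  by exists p; exact: connected_component_refl.
have [w cell] := face_cell plane adj bF F0.
set d := (8 * n%:R)^-1 in cell.
have d0 : 0 < d by rewrite invr_gt0; lra.
apply: (@le_trans _ _ ((h (pt R w + d) - h (pt R w - d)) * (q 2^-1 - q 4^-1))%:E).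
  rewrite lee_fin; have -> : 16^-1 / n%:R = (2 * n%:R)^-1 * 8^-1 :> R.
    by field; rewrite gt_eqF//; lra.
  apply: ler_pM; rewrite ?invr_ge0//.
    by rewrite hE; exact: hstretch_cell.
  by rewrite qE; exact: vstretch_cell.
apply: area_ge_box.
- exact: face_open.
- by rewrite lh_le; lra.
- by rewrite lh_le; lra.
(* As [h] and [q] are increasing, a point of the box pulls back into the cell of [w]. *)
move=> z [/=]; rewrite !in_itv /= -[z](@unwarpK R h q) /= !lh_le.
move=> /andP[x0 x1] yb; apply: cell => //.
by rewrite ler_norml; apply/andP; split; lra.
Qed.
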